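(* Let $W$ be a fundamental matrix of the $n\times n$ linear system $\frac{d}{dx}\vec\psi=A\vec\psi$ and put $Z=W^{-1}$. Let $W_\rho$ be a fundamental matrix of the deformed system $$\frac{d}{dx}\vec\psi=A\vec\psi+\rho B\vec\psi .$$ Then $W_\rho$ can be written as a Dyson-type series $$W_\rho = W\left(I+\Big(\int ZBZ^{-1}\Big)\rho+\Big(\int ZBZ^{-1}\int ZBZ^{-1}\Big)\rho^2+\cdots\right).$$
   Context: $A=A(x)$ is the original $n\times n$ coefficient matrix and $B=B(x)$ is the perturbation matrix, with parameter $\rho$. The parameter $\rho$ is treated as a formal variable (or as a sufficiently small complex parameter, so that the series converges in some sense), and the series is a formal series solution in $\rho$. It is assumed that $\frac{d}{dx}\vec\psi=A\vec\psi$ admits $n$ linearly independent solutions, so that its fundamental matrix is generically invertible. A fundamental matrix of a linear system is a matrix whose columns form a basis of solutions, so $W'=AW$ and $W_\rho'=(A+\rho B)W_\rho$; fundamental matrices are defined only up to a (constant) change of basis, and the formula for $W_\rho$ is understood with this convention. The integrals are iterated integrals in $x$: the coefficient of $\rho^k$ in the bracket is $C_k$, where $C_0=I$ and $C_k=\int ZBZ^{-1}C_{k-1}\,dx$. *)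

(* Defs.v *)
From HB Require Import structures.
From mathcomp Require Import all_boot all_order all_algebra.
From mathcomp Require Import all_classical all_reals all_analysis.
Set Implicit Arguments.
Unset Strict Implicit.
Unset Printing Implicit Defensive.
Import Order.TTheory GRing.Theory Num.Theory.
Import numFieldNormedType.Exports.
Local Open Scope classical_set_scope.
Local Open Scope ring_scope.

Section LinearSystems.
Variable K : numFieldType.
Implicit Types (D : set K) (m n p : nat).

Definition mx_continuous_on D n (A : K -> 'M[K]_n) : Prop :=
  forall x, D x -> forall i j, {for x, continuous (fun y : K => A y i j)}.

(* F' = G on D, entrywise; for K = R[i] this is the complex derivative. *)
Definition mx_derive_on D m p (F G : K -> 'M[K]_(m, p)) : Prop :=
  forall x, D x -> forall i j, is_derive x 1 (fun y : K => F y i j) (G x i j).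

Definition is_solution D n p (A : K -> 'M[K]_n) (Y : K -> 'M[K]_(n, p)) : Prop :=
  mx_derive_on D Y (fun x => A x *m Y x).

(* The columns of W form a basis of the solution space over the constants. *)
Definition is_fundamental D n (A W : K -> 'M[K]_n) : Prop :=
  [/\ is_solution D A W,
      (forall c : 'cV[K]_n, (forall x, D x -> W x *m c = 0) -> c = 0)
    & (forall psi : K -> 'cV[K]_n, is_solution D A psi ->
         exists c : 'cV[K]_n, forall x, D x -> psi x = W x *m c)].

(* A formal power series in rho with m x p matrix coefficients; [S k] is the
   coefficient of rho ^ k. *)
Definition mxseries m p := nat -> 'M[K]_(m, p).

Definition mxseries_mul m n p (S : mxseries m n) (T : mxseries n p) :
  mxseries m p := fun k => \sum_(i < k.+1) S i *m T (k - i)%N.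

Definition mxseries1 n : mxseries n n := fun k => if k is 0%N then 1%:M else 0.

Definition mxseries_invertible n (P : mxseries n n) : Prop :=
  exists Q : mxseries n n,
    mxseries_mul P Q =1 @mxseries1 n /\ mxseries_mul Q P =1 @mxseries1 n.

(* The series A + B rho. *)
Definition deformed n (A B : K -> 'M[K]_n) (x : K) : mxseries n n :=
  fun k => match k with 0%N => A x | 1%N => B x | _ => 0 end.

(* Y' = (A + rho B) Y on D, where d/dx acts on each coefficient of Y. *)
Definition is_formal_solution D n p (A B : K -> 'M[K]_n)
    (Y : K -> mxseries n p) : Prop :=
  forall k, mx_derive_on D (fun x => Y x k)
    (fun x => mxseries_mul (deformed A B x) (Y x) k).

(* As for [is_fundamental], the constants now being the formal power series
   in rho that do not depend on x. *)
Definition is_formal_fundamental D n (A B : K -> 'M[K]_n)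
    (Wrho : K -> mxseries n n) : Prop :=
  [/\ is_formal_solution D A B Wrho,
      (forall c : mxseries n 1,
         (forall x, D x -> forall k, mxseries_mul (Wrho x) c k = 0) ->
         forall k, c k = 0)
    & (forall psi : K -> mxseries n 1, is_formal_solution D A B psi ->
         exists c : mxseries n 1,
           forall x, D x -> psi x =1 mxseries_mul (Wrho x) c)].

(* C is a choice of the iterated indefinite integrals
   C_0 = I, C_k = \int M C_(k-1) dx; the constants of integration are free. *)
Definition iterated_integrals D n (M : K -> 'M[K]_n)
    (C : nat -> K -> 'M[K]_n) : Prop :=
  (forall x, D x -> C 0%N x = 1%:M) /\
  (forall k, mx_derive_on D (C k.+1) (fun x => M x *m C k x)).

(* W (I + C_1 rho + C_2 rho ^ 2 + ...) *)
Definition dyson_series n (W : K -> 'M[K]_n) (C : nat -> K -> 'M[K]_n) (x : K) :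
  mxseries n n := fun k => W x *m C k x.

End LinearSystems.

(* Main.v *)
Require Import Defs.
From HB Require Import structures.
From mathcomp Require Import all_boot all_order all_algebra.
From mathcomp Require Import all_classical all_reals all_analysis.
From mathcomp Require Import complex.
From mathcomp Require Import perm.
Set Implicit Arguments.
Unset Strict Implicit.
Unset Printing Implicit Defensive.
Import Order.TTheory GRing.Theory Num.Theory.
Import numFieldNormedType.Exports.
Local Open Scope classical_set_scope.
Local Open Scope ring_scope.

(* A solution of a linear system on a connected open set that vanishes at one
   point vanishes everywhere, both for Y' = A Y and, coefficient by coefficient,
   for Y' = (A + rho B) Y.  Variation of constants, with Z' = - Z A, shows that
   the series W (sum C_k rho^k) is a formal solution exactly when
   C_k' = Z B W C_(k-1).  If S and Y are formal solutions and S(x0) is invertible,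
   then Y = S c with the constant series c = S(x0)^-1 Y(x0); this c is the change
   of basis from a Dyson series to W_rho.  It is invertible because the order 0
   coefficient of W_rho is itself a fundamental matrix of Y' = A Y. *)

(* What the real line and the complex plane have in common: [re] is the
   projection of K onto the copy [iota] of the reals inside it. *)
Record real_projection (R : realType) (K : numFieldType)
    (iota : {rmorphism R -> K}) (re : K -> R) : Prop := RealProjection {
  rp_le : forall a b, (iota a <= iota b) = (a <= b);
  rp_onto : forall e, 0 <= e -> exists d, e = iota d;
  rp_sub : forall x y, re (x - y) = re x - re y;
  rp_scale : forall a z, re (iota a * z) = a * re z;
  rp_id : forall a, re (iota a) = a;
  rp_norm : forall z, iota `|re z| <= `|z| }.

Lemma real_projection_exists (R : realType) (K : numFieldType) :
  K = (R : numFieldType) \/ K = (complex R : numFieldType) ->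
  exists (iota : {rmorphism R -> K}) (re : K -> R), real_projection iota re.
Proof.
case=> ->.
  exists idfun, id; split => //= e _; by exists e.
exists (real_complex R), (@complex.Re R); split => //.
- by move=> a b; rewrite lecR.
- by move=> e e0; have /complex_realP[d ->] := ger0_real e0; exists d.
- by move=> x y; rewrite raddfB.
- by move=> a [x y] /=; rewrite mul0r subr0.
- exact: normc_ge_Re.
Qed.

(** The differential is linear over [K], so direction 1 determines every direction [v]. *)
Lemma is_derive1_dir (K : numFieldType) (f : K -> K) (x v d : K) :
  is_derive x 1 f d -> is_derive x v f (v * d).
Proof.
move=> [/derivable1_diffP df fd]; apply: DeriveDef.
  exact: diff_derivable.
rewrite deriveE // -[in LHS](mulr1 v) -[v * 1]/(v *: 1) linearZ /=.
by rewrite -deriveE // fd.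
Qed.

Lemma is_derive1_continuous (K : numFieldType) (f : K -> K) (x d : K) :
  is_derive x 1 f d -> {for x, continuous f}.
Proof. by move=> [/derivable1_diffP/differentiable_continuous]. Qed.

(** * Mean value bound and uniqueness for linear systems *)

Section RealProjection.
Variables (R : realType) (K : numFieldType).
Variables (iota : {rmorphism R -> K}) (re : K -> R).
Hypothesis rpK : real_projection iota re.

Let iota_lt a b : (iota a < iota b) = (a < b).
Proof. by rewrite !lt_neqAle (rp_le rpK) (inj_eq (fmorph_inj _)). Qed.

Let iota_norm a : `|iota a| = iota `|a|.
Proof.
have [a0|a0] := leP 0 a.
  by rewrite (ger0_norm a0) ger0_norm // -(rmorph0 iota) (rp_le rpK).
by rewrite (ltr0_norm a0) rmorphN ltr0_norm // -(rmorph0 iota) iota_lt.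
Qed.

Let continuous_iota : continuous iota.
Proof.
move=> t; apply/cvgrPdist_lt => e e0.
(* A positive tolerance in [K] is a real element, so the estimate can be made in [R]. *)
have [d de] := rp_onto rpK (ltW e0).
move: e0; rewrite de -(rmorph0 iota) iota_lt => d0.
near=> s; rewrite -rmorphB iota_norm iota_lt.
by near: s; apply: cvgr_dist_lt.
Unshelve. all: by end_near. Qed.

Let continuous_re : continuous re.
Proof.
move=> z; apply/(@cvgrPdist_lt _ _ _ (nbhs z) _ re) => e e0.
near=> w; rewrite -(rp_sub rpK) -iota_lt; apply: le_lt_trans (rp_norm rpK _) _.
near: w; apply: cvgr_dist_lt => //; by rewrite -(rmorph0 iota) iota_lt.
Unshelve. all: by end_near. Qed.

(** The real difference quotient is the image under [re (c * _)] of the quotient of [f] in direction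
    [v], taken at increments in the image of [iota]. As [iota] is continuous and injective, it
    carries the punctured neighbourhoods of 0 over. *)
Let is_derive_re_line (f : K -> K) (c x0 v d : K) (t : R) :
  is_derive (x0 + iota t * v) 1 f d ->
  is_derive t 1 (fun s => re (c * f (x0 + iota s * v))) (re (c * (v * d))).
Proof.
move=> /(is_derive1_dir v)[].
set y := x0 + _ * v => df fd.
have H : (fun h : K => h^-1 *: (f (h *: v + y) - f y)) @ 0^' --> v * d.
  by rewrite -fd; exact: df.
set h := fun s : R => _.
have {}H : (fun s : R => s^-1 *: (h (s *: 1 + t) - h t)) @ 0^' -->
    re (c * (v * d)).
  have -> : (fun s : R => s^-1 *: (h (s *: 1 + t) - h t)) =
    (fun z : K => re (c * z)) \o
      ((fun h : K => h^-1 *: (f (h *: v + y) - f y)) \o iota).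
    apply/funext => s /=; rewrite /h -(rp_sub rpK) -mulrBr.
    have -> : x0 + iota (s *: 1 + t) * v = iota s *: v + y.
      by rewrite /y addrCA -mulrDl rmorphD [s *: 1]mulr1.
    rewrite -scalerAr /= -fmorphV; exact: esym (rp_scale rpK _ _).
  apply: (@cvg_comp _ _ _ _ _ _ (nbhs (v * d : K))); last first.
    apply: (@cvg_comp _ _ _ _ _ _ (nbhs (c * (v * d) : K))).
      by apply: cvgMl_tmp; exact: cvg_id.
    exact: continuous_re.
  apply: cvg_comp H.
  have := continuous_injective_withinNx (@continuous_iota 0).
  by rewrite rmorph0; apply=> s /eqP; rewrite fmorph_eq0 => /eqP.
apply: DeriveDef; last exact: cvg_lim H.
by apply/cvg_ex; exists (re (c * (v * d))).
Qed.

(* Multiply f by the unit c that turns f x - f x0 into its modulus, and apply the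
   real mean value theorem to re (c * f) along the segment from x0 to x. *)
Let mean_value_bound (f g : K -> K) (x0 r M : K) :
    (forall y, ball x0 r y -> is_derive y 1 f (g y)) ->
    (forall y, ball x0 r y -> `|g y| <= M) ->
  forall x, ball x0 r x -> `|f x - f x0| <= M * `|x - x0|.
Proof.
move=> df gM x xr.
set v := x - x0; set u := f x - f x0.
have [->|u0] := eqVneq u 0.
  rewrite normr0 mulr_ge0 //; apply: le_trans (gM _ xr); exact: normr_ge0.
pose c := `|u| / u; pose h s := re (c * f (x0 + iota s * v)).
have c1 : `|c| = 1 by rewrite normrM normfV normr_id divff // normr_eq0.
have seg (s : R) : 0 <= s <= 1 -> ball x0 r (x0 + iota s * v).
  case/andP=> s0 s1; move: xr; rewrite /ball /= => /(le_lt_trans _); apply.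
  rewrite opprD addNKr normrN normrM iota_norm (ger0_norm s0) (distrC x0).
  rewrite ler_piMl // -(rmorph1 iota) (rp_le rpK) //.
have dh (s : R) : 0 <= s <= 1 ->
    is_derive s 1 h (re (c * (v * g (x0 + iota s * v)))).
  by move=> s01; apply: is_derive_re_line; apply: df; exact: seg.
have [s||s] := @MVT_segment R h
  (fun s => re (c * (v * g (x0 + iota s * v)))) 0 1 ler01.
- by rewrite in_itv /= => /andP[/ltW s0 /ltW s1]; apply: dh; rewrite s0.
- apply: continuous_in_subspaceT => s.
  by rewrite inE /= in_itv /= => /dh/is_derive1_continuous.
rewrite in_itv /= subr0 mulr1 => s01.
rewrite /h -(rp_sub rpK) -mulrBr rmorph1 rmorph0 mul1r mul0r addr0.
have -> : x0 + v = x by rewrite addrC subrK.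
rewrite -/u divfK // => E.
have [d ud] := rp_onto rpK (normr_ge0 u).
have -> : `|u| = iota (re `|u|) by rewrite ud (rp_id rpK).
rewrite E; set z := c * _.
have : `|z| <= M * `|v|.
  by rewrite /z normrM c1 mul1r normrM mulrC ler_wpM2r //; apply: gM; exact: seg.
apply: le_trans; apply: le_trans (rp_norm rpK z).
by rewrite (rp_le rpK) ler_norm.
Qed.

(** The norm is a real element, so the Archimedean property of [R] applies. *)
Lemma norm_le_half_powers_eq0 (a : K) : (forall k, `|a| <= 2 ^- k) -> a = 0.
Proof.
move=> a2; apply/eqP; rewrite -normr_eq0.
have [d ad] := rp_onto rpK (normr_ge0 a).
have d0 : 0 <= d by rewrite -(rp_le rpK) rmorph0 -ad.
rewrite ad fmorph_eq0 eq_le d0 andbT.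
apply/ler_addgt0Pl => e e0; rewrite addr0.
have [k ke] : exists k, 2 ^- k < e.
  exists (Num.bound e^-1); rewrite -[ltRHS]invrK ltf_pV2 ?posrE ?invr_gt0 ?exprn_gt0//.
  exact: upper_nthrootP.
apply/ltW; apply: le_lt_trans ke.
by rewrite -(rp_le rpK) -ad fmorphV rmorphXn rmorph_nat; exact: a2.
Qed.

(** A contraction argument without integrals: on a small ball, a bound on [Y] bounds [Y'], and the
    mean value bound then returns half the bound on [Y]. *)
Lemma solution_eq0_near (D : set K) (n p : nat) (A : K -> 'M[K]_n)
    (Y : K -> 'M[K]_(n, p)) (x0 : K) :
  open D -> mx_continuous_on D A -> is_solution D A Y -> D x0 -> Y x0 = 0 ->
  \forall x \near x0, Y x = 0.
Proof.
move=> openD contA solY Dx0 Y0.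
(* The summand 1 makes [a] strictly larger than each entry at [x0], so continuity keeps the entries
   below [a] nearby. *)
pose a : K := 1 + \sum_i \sum_j `|A x0 i j|.
have a0 : 0 < a by rewrite ltr_wpDr// !sumr_ge0// => i _; exact: sumr_ge0.
have Aa i j : `|A x0 i j| < a.
  rewrite (le_lt_trans (y := \sum_i \sum_j `|A x0 i j|)) ?ltrDr//.
  rewrite (bigD1 i)//= (bigD1 j)//= -addrA lerDl addr_ge0// !sumr_ge0// => k _.
  exact: sumr_ge0.
(* [N] bounds the growth of the largest entry under multiplication by [A]. It is 0 when [n] is 0,
   hence the division by [N + 1] below. *)
pose N : K := n%:R * a.
have N1 : 0 < N + 1 by rewrite ltr_wpDl// mulr_ge0// ltW.
have : \forall x \near x0, [/\ D x, (forall i j, `|A x i j| <= a),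
    (forall i j, `|Y x i j| <= 1) & N * `|x - x0| <= 2^-1].
  near=> x; split.
  - by near: x; exact: open_nbhs_nbhs.
  - move=> i j; move: i j; near: x.
    apply: filter_forall => i; apply: filter_forall => j.
    by have /cvgr_norm_le := contA x0 Dx0 i j; apply.
  - move=> i j; move: i j; near: x.
    apply: filter_forall => i; apply: filter_forall => j.
    have /cvgr_norm_le := is_derive1_continuous (solY x0 Dx0 i j); apply.
    by rewrite Y0 mxE normr0.
  - have xN : `|x - x0| <= 2^-1 / (N + 1).
      rewrite distrC; near: x; apply: cvgr_dist_le; first exact: cvg_id.
      by rewrite divr_gt0// invr_gt0.
    apply: (@le_trans _ _ ((N + 1) * `|x - x0|)).
      by rewrite ler_wpM2r// lerDl.
    by rewrite mulrC -ler_pdivlMr.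
move=> /nbhs_ballP[r r0 rP].
(* Since n a |x - x0| <= 1/2 on the ball, every bound on the entries of Y can be
   halved. *)
have bound k : forall x, ball x0 r x -> forall i j, `|Y x i j| <= 2 ^- k.
  elim: k => [|k IH] x xr i j; first by rewrite expr0 invr1; have [] := rP x xr.
  have := @mean_value_bound (fun y => Y y i j) (fun y => (A y *m Y y) i j) x0 r
    (N * 2 ^- k) _ _ x xr.
  rewrite Y0 mxE subr0; move=> /(_ _ _)/le_trans; apply.
  - by move=> y yr; apply: solY; have [] := rP y yr.
  - move=> y yr; rewrite mxE (le_trans (ler_norm_sum _ _ _))//.
    rewrite /N mulrAC -mulrA mulr_natl -[in leRHS](card_ord n) -sumr_const.
    apply: ler_sum => l _; rewrite normrM mulrC ler_pM//.
      exact: IH.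
    by have [] := rP y yr.
  rewrite mulrAC exprS invfM ler_wpM2r ?invr_ge0 ?exprn_ge0//.
  by have [] := rP x xr.
exists r => // x xr; apply/matrixP => i j; rewrite mxE.
by apply: norm_le_half_powers_eq0 => k; exact: bound.
Unshelve. all: by end_near. Qed.

(** The zero set is open by local uniqueness and closed in [D] by continuity of the entries, so
    connectedness makes it all of [D]. *)
Lemma solution_eq0 (D : set K) (n p : nat) (A : K -> 'M[K]_n)
    (Y : K -> 'M[K]_(n, p)) (x0 : K) :
  open D -> connected D -> mx_continuous_on D A -> is_solution D A Y ->
  D x0 -> Y x0 = 0 -> forall x, D x -> Y x = 0.
Proof.
move=> openD connD contA solY Dx0 Y0.
pose S := D `&` [set x | Y x = 0].
have SS x : S x -> nbhs x S.
  move=> [Dx Yx0]; apply: filterI; first exact: open_nbhs_nbhs.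
  exact: (solution_eq0_near openD contA solY Dx Yx0).
have clS : D `&` closure S `<=` S.
  move=> x [Dx clx]; split => //=; apply/matrixP => i j; rewrite mxE.
  apply/eqP; apply: contrapT => /negP Yx.
  have := is_derive1_continuous (solY x Dx i j).
  move=> /(_ [set y | y != 0]) /=.
  have /[swap]/[apply] : nbhs (Y x i j) [set y : K | y != 0].
    apply/nbhs_ballP; exists `|Y x i j|; first by rewrite /= normr_gt0.
    by move=> y /= Yxy; apply/eqP => y0; move: Yxy; rewrite y0 /ball /= subr0 ltxx.
  move=> /clx [y [[_ /= ->]]]; by rewrite /= mxE eqxx.
suff SD : S = D by move=> x; rewrite -SD => -[].
apply: connD.
- by exists x0.
- exists S; first by rewrite openE => x /SS.
  by rewrite /S setIA setIid.
- exists (closure S); first exact: closed_closure.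
  apply/seteqP; split => // x Sx; split; first by case: Sx.
  exact: subset_closure.
Qed.

End RealProjection.

(** * Algebra of formal matrix series in rho *)

Section SeriesAlgebra.
Variable K : numFieldType.

Lemma mxseries_mulA (m n p q : nat) (S : mxseries K m n) (T : mxseries K n p)
    (U : mxseries K p q) :
  mxseries_mul S (mxseries_mul T U) = mxseries_mul (mxseries_mul S T) U.
Proof.
apply/funext => k; rewrite /mxseries_mul.
(* Here [i] is the joint degree of [S] and [T]; both sides sum [F j i] over the triangle j <= i <=
   k. *)
pose F j i := S j *m T (i - j)%N *m U (k - i)%N.
transitivity (\sum_(j < k.+1) \sum_(i < k.+1 | (j <= i)%N) F j i); last first.
  rewrite (exchange_big_dep xpredT) //=; apply: eq_bigr => i _.
  rewrite mulmx_suml (big_ord_narrow_leq (F := fun j => F j i)) //.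
  by rewrite -ltnS.
apply: eq_bigr => j _.
have jk : (j <= k)%N by rewrite -ltnS.
transitivity (\sum_(0 <= l < (k - j).+1) F j (l + j)%N).
  rewrite big_mkord mulmx_sumr; apply: eq_bigr => l _.
  by rewrite /F addnK mulmxA -subnDA addnC.
by rewrite -(subSn jk) -(big_addn _ _ _ xpredT (F j)) add0n big_geq_mkord.
Qed.

Lemma mxseries_mul1l (n p : nat) (S : mxseries K n p) :
  mxseries_mul (@mxseries1 K n) S = S.
Proof.
apply/funext => k; rewrite /mxseries_mul big_ord_recl /= mul1mx subn0 big1 ?addr0//.
by move=> i _; rewrite mul0mx.
Qed.

Lemma mxseries_mul1r (n p : nat) (S : mxseries K n p) :
  mxseries_mul S (@mxseries1 K p) = S.
Proof.
apply/funext => k; rewrite /mxseries_mul big_ord_recr /= subnn mulmx1 big1 ?add0r//.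
by move=> i _; case: (k - i)%N (subn_gt0 i k) => [|l]; rewrite ?ltn_ord ?mulmx0.
Qed.

Lemma mxseries_mul_coef0 (m n p : nat) (S : mxseries K m n) (T : mxseries K n p) :
  mxseries_mul S T 0 = S 0%N *m T 0%N.
Proof. by rewrite /mxseries_mul big_ord1. Qed.

(** The system is triangular: order k determines [U k] from the earlier coefficients once [S 0] can
    be inverted. *)
Lemma mxseries_mul_solve (n p : nat) (S : mxseries K n n) (T : mxseries K n p) :
  S 0%N \in unitmx -> exists U, mxseries_mul S U = T.
Proof.
move=> S0.
(* [pre k] lists the first k coefficients of [U], and [next] computes the following one from that
   list. *)
pose next l := invmx (S 0%N) *m (T (size l) -
  \sum_(i < size l) S i.+1 *m nth 0 l (size l - i.+1)%N).
pose pre := fix pre k := if k is k'.+1 then rcons (pre k') (next (pre k')) else [::].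
have size_pre k : size (pre k) = k by elim: k => //= k IH; rewrite size_rcons IH.
pose U k := nth 0 (pre k.+1) k.
have nth_pre k i : (i < k)%N -> nth 0 (pre k) i = U i.
  elim: k => // k IH; rewrite ltnS leq_eqVlt => /orP[/eqP->//|ik].
  by rewrite /= nth_rcons size_pre ik IH.
exists U; apply/funext => k; rewrite /mxseries_mul big_ord_recl /= subn0.
rewrite {1}/U /= nth_rcons size_pre ltnn eqxx /next size_pre mulKVmx //.
rewrite addrC [X in _ + (_ - X)](_ : _ = \sum_(i < k) S i.+1 *m U (k - i.+1)%N).
  by rewrite addrCA subrr addr0.
by apply: eq_bigr => i _; rewrite nth_pre // ltn_subrL /= (leq_ltn_trans _ (ltn_ord i)).
Qed.

(** A right inverse [T] of [S] has a right inverse [U] in turn, and associativity forces [U] to be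
    [S]. *)
Lemma mxseries_unit_invertible (n : nat) (S : mxseries K n n) :
  S 0%N \in unitmx -> mxseries_invertible S.
Proof.
move=> S0; have [T ST] := mxseries_mul_solve (@mxseries1 K n) S0.
have T0 : T 0%N \in unitmx.
  have := congr1 (@^~ 0%N) ST; rewrite mxseries_mul_coef0 /=.
  by move=> /mulmx1_unit[].
have [U TU] := mxseries_mul_solve (@mxseries1 K n) T0.
exists T; rewrite ST; split => //.
suff -> : S = U by rewrite TU.
by rewrite -(mxseries_mul1r S) -TU mxseries_mulA ST mxseries_mul1l.
Qed.

End SeriesAlgebra.

(** * Entrywise differentiation of matrix functions *)

Section MatrixDerivative.
Variables (K : numFieldType) (D : set K).
Hypothesis openD : open D.

(** As [D] is open, functions equal on [D] agree near each of its points and so have the same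
    derivative there. *)
Lemma mx_derive_on_eq (m p : nat) (F F' G G' : K -> 'M[K]_(m, p)) :
  (forall x, D x -> F x = F' x) -> (forall x, D x -> G x = G' x) ->
  mx_derive_on D F G -> mx_derive_on D F' G'.
Proof.
move=> FF GG dF x Dx i j; rewrite -GG //.
apply: near_eq_is_derive (dF x Dx i j).
have : nbhs x D by exact: open_nbhs_nbhs.
by apply: filterS => y Dy; rewrite FF.
Qed.

Lemma mx_derive_on_cst (m p : nat) (c : 'M[K]_(m, p)) :
  mx_derive_on D (fun=> c) (fun=> 0).
Proof. by move=> x Dx i j; rewrite mxE; exact: is_derive_cst. Qed.

Lemma mx_derive_on_sub (m p : nat) (F F' G G' : K -> 'M[K]_(m, p)) :
  mx_derive_on D F F' -> mx_derive_on D G G' ->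
  mx_derive_on D (fun x => F x - G x) (fun x => F' x - G' x).
Proof.
move=> dF dG x Dx i j.
have -> : (fun y => (F y - G y) i j) = (F^~ i)^~ j - (G^~ i)^~ j.
  by apply/funext => y; rewrite !mxE.
by rewrite !mxE; apply: is_deriveB; [exact: dF | exact: dG].
Qed.

Lemma mx_derive_on_sum (k m p : nat) (F F' : 'I_k -> K -> 'M[K]_(m, p)) :
  (forall l, mx_derive_on D (F l) (F' l)) ->
  mx_derive_on D (fun x => \sum_l F l x) (fun x => \sum_l F' l x).
Proof.
move=> dF x Dx i j; rewrite summxE.
have -> : (fun y => (\sum_l F l y) i j) = \sum_l (fun y => F l y i j).
  by apply/funext => y; rewrite summxE fct_sumE.
by apply: is_derive_sum => l; exact: dF.
Qed.

Lemma mx_derive_on_mul (m n p : nat) (F F' : K -> 'M[K]_(m, n))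
    (G G' : K -> 'M[K]_(n, p)) :
  mx_derive_on D F F' -> mx_derive_on D G G' ->
  mx_derive_on D (fun x => F x *m G x) (fun x => F' x *m G x + F x *m G' x).
Proof.
move=> dF dG x Dx i j.
have -> : (fun y => (F y *m G y) i j) =
    \sum_k ((fun y => F y i k) * (fun y => G y k j)).
  by apply/funext => y; rewrite mxE fct_sumE.
have -> : (F' x *m G x + F x *m G' x) i j =
    \sum_k (F x i k *: G' x k j + G x k j *: F' x i k).
  rewrite !mxE -big_split /=; apply: eq_bigr => k _.
  by rewrite addrC [G x k j *: _]mulrC.
by apply: is_derive_sum => k; apply: is_deriveM; [exact: dF | exact: dG].
Qed.

Lemma derivable_det (n : nat) (F : K -> 'M[K]_n) (x : K) :
  (forall i j, derivable (fun y => F y i j) x 1) ->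
  derivable (fun y => \det (F y)) x 1.
Proof.
move=> dF; rewrite /determinant.
have -> : (fun y => \sum_(s : {perm 'I_n}) (-1) ^+ s * \prod_i F y i (s i)) =
    \sum_(s : {perm 'I_n}) (cst ((-1) ^+ s) * \prod_i (fun y => F y i (s i))).
  apply/funext => y; rewrite fct_sumE; apply: eq_bigr => s _.
  by rewrite fct_prodE.
elim/big_ind: _ => [|f g|s _]; [exact: derivable_cst|exact: derivableD|].
apply: derivableM; first exact: derivable_cst.
by elim/big_ind: _ => [|f g|i _]; [exact: derivable_cst|exact: derivableM|].
Qed.

(** The adjugate formula shows that the inverse is differentiable; differentiating Z W = I then
    gives the value of its derivative. *)
Lemma mx_derive_on_inv (n : nat) (A W : K -> 'M[K]_n) :
  is_solution D A W -> (forall x, D x -> W x \in unitmx) ->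
  mx_derive_on D (fun x => invmx (W x)) (fun x => - (invmx (W x) *m A x)).
Proof.
move=> solW unitW.
pose Z x := (\det (W x))^-1 *: \adj (W x).
have ZE x : D x -> Z x = invmx (W x) by move=> Dx; rewrite /invmx unitW.
pose Z' x := \matrix_(i, j) ('D_1 (fun y => Z y i j) x).
have dW x i j : D x -> derivable (fun y => W y i j) x 1.
  by move=> Dx; have [] := solW x Dx i j.
have dZ : mx_derive_on D Z Z'.
  move=> x Dx i j; rewrite mxE; apply: derivableP.
  have -> : (fun y => Z y i j) =
      (fun y => (\det (W y))^-1) * (cst ((-1) ^+ (j + i)) *
        (fun y => \det (row' j (col' i (W y))))).
    by apply/funext => y; rewrite /Z !mxE.
  apply: derivableM; last apply: derivableM.
  - apply: derivableV; first by have := unitW x Dx; rewrite unitmxE unitfE.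
    by apply: derivable_det => k l; exact: dW.
  - exact: derivable_cst.
  - apply: derivable_det => k l.
    under eq_fun do rewrite !mxE.
    exact: dW.
have dZW : mx_derive_on D (fun=> 1%:M) (fun x => Z' x *m W x + Z x *m (A x *m W x)).
  apply: mx_derive_on_eq (mx_derive_on_mul dZ solW) => // x Dx.
  by rewrite ZE // mulVmx // unitW.
apply: mx_derive_on_eq dZ => x Dx; first exact: ZE.
have E : Z' x *m W x + Z x *m (A x *m W x) = 0.
  apply/matrixP => i j; have [_ <-] := dZW x Dx i j.
  by have [_ ->] := mx_derive_on_cst 1%:M Dx i j.
rewrite -ZE // -[LHS](mulmxK (unitW x Dx)) -[X in X *m _](addrK (Z x *m (A x *m W x))).
by rewrite E sub0r mulNmx !mulmxA mulmxK // unitW.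
Qed.

End MatrixDerivative.

Lemma mulmx_cV_inj_unitmx (K : fieldType) (n : nat) (M : 'M[K]_n) :
  (forall c : 'cV_n, M *m c = 0 -> c = 0) -> M \in unitmx.
Proof.
move=> M0; rewrite -unitmx_tr unitmxE unitfE; apply/det0P => -[v v0 vM].
move/eqP: v0; apply; apply: trmx_inj; rewrite trmx0; apply: M0.
by rewrite -[LHS]trmxK trmx_mul trmxK vM trmx0.
Qed.

(** * Formal solutions of the deformed system *)

Section FormalSystem.
Variables (R : realType) (K : numFieldType).
Variables (iota : {rmorphism R -> K}) (re : K -> R).
Hypothesis rpK : real_projection iota re.
Variables (D : set K) (n : nat) (A B : K -> 'M[K]_n).
Hypotheses (openD : open D) (connD : connected D).
Hypothesis contA : mx_continuous_on D A.

Lemma mxseries_mul_deformed0 (p : nat) (x : K) (Y : mxseries K n p) :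
  mxseries_mul (deformed A B x) Y 0%N = A x *m Y 0%N.
Proof. exact: mxseries_mul_coef0. Qed.

Lemma mxseries_mul_deformedS (p : nat) (x : K) (Y : mxseries K n p) (k : nat) :
  mxseries_mul (deformed A B x) Y k.+1 = A x *m Y k.+1 + B x *m Y k.
Proof.
rewrite /mxseries_mul 2!big_ord_recl /= subn0 subn1 big1 ?addr0// => i _.
by rewrite mul0mx.
Qed.

Lemma is_solution_mulr (p q : nat) (Y : K -> 'M[K]_(n, p)) (c : 'M[K]_(p, q)) :
  is_solution D A Y -> is_solution D A (fun x => Y x *m c).
Proof.
move=> solY.
apply: (mx_derive_on_eq openD _ _ (mx_derive_on_mul solY (mx_derive_on_cst c))) => // x _.
by rewrite mulmx0 addr0 mulmxA.
Qed.

Lemma is_formal_solution_mulr (p q : nat) (Y : K -> mxseries K n p)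
    (c : mxseries K p q) :
  is_formal_solution D A B Y ->
  is_formal_solution D A B (fun x => mxseries_mul (Y x) c).
Proof.
move=> solY k.
apply: (mx_derive_on_eq openD _ _ (mx_derive_on_sum
  (F := fun (i : 'I_k.+1) x => Y x i *m c (k - i)%N)
  (F' := fun i x => mxseries_mul (deformed A B x) (Y x) i *m c (k - i)%N) _)) => //.
  by move=> x _; rewrite mxseries_mulA.
move=> i.
apply: (mx_derive_on_eq openD _ _ (mx_derive_on_mul (solY i)
  (mx_derive_on_cst (c (k - i)%N)))) => // x _.
by rewrite mulmx0 addr0.
Qed.

Lemma is_formal_solution_sub (p : nat) (Y1 Y2 : K -> mxseries K n p) :
  is_formal_solution D A B Y1 -> is_formal_solution D A B Y2 ->
  is_formal_solution D A B (fun x k => Y1 x k - Y2 x k).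
Proof.
move=> sol1 sol2 k.
apply: (mx_derive_on_eq openD _ _ (mx_derive_on_sub (sol1 k) (sol2 k))) => // x _.
by rewrite -sumrB; apply: eq_bigr => i _; rewrite mulmxBr.
Qed.

Lemma formal_solution0 (p : nat) (Y : K -> mxseries K n p) :
  is_formal_solution D A B Y -> is_solution D A (fun x => Y x 0%N).
Proof.
move=> /(_ 0%N); apply: (mx_derive_on_eq openD) => // x _.
exact: mxseries_mul_deformed0.
Qed.

(** Once order k vanishes, the equation at order k + 1 loses its [B] term and becomes Y' = A Y. *)
Lemma formal_solution_eq0 (p : nat) (Y : K -> mxseries K n p) (x0 : K) :
  is_formal_solution D A B Y -> D x0 -> (forall k, Y x0 k = 0) ->
  forall k x, D x -> Y x k = 0.
Proof.
move=> solY Dx0 Y0; elim=> [|k IH].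
  exact: (solution_eq0 rpK openD connD contA (formal_solution0 solY) Dx0 (Y0 _)).
apply: (solution_eq0 rpK openD connD contA _ Dx0 (Y0 _)).
apply: (mx_derive_on_eq openD _ _ (solY k.+1)) => // x Dx.
by rewrite mxseries_mul_deformedS IH // mulmx0 addr0.
Qed.

Lemma formal_solution_factor (p : nat) (S : K -> mxseries K n n)
    (Y : K -> mxseries K n p) (x0 : K) :
  is_formal_solution D A B S -> is_formal_solution D A B Y ->
  D x0 -> S x0 0%N \in unitmx ->
  exists c : mxseries K n p, forall x, D x -> Y x = mxseries_mul (S x) c.
Proof.
move=> solS solY Dx0 unitS.
have [c cE] := mxseries_mul_solve (Y x0) unitS.
exists c => x Dx; apply/funext => k; apply/eqP; rewrite -subr_eq0; apply/eqP.
have sol := is_formal_solution_sub solY (is_formal_solution_mulr c solS).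
by apply: (formal_solution_eq0 sol Dx0) Dx => l; rewrite cE subrr.
Qed.

(** A kernel vector c of [W x0] yields a solution W c vanishing at [x0], hence on [D], so
    independence of the columns gives c = 0. *)
Lemma fundamental_unitmx (W : K -> 'M[K]_n) (x0 : K) :
  is_fundamental D A W -> D x0 -> W x0 \in unitmx.
Proof.
move=> [solW freeW _] Dx0; apply: mulmx_cV_inj_unitmx => c Wc; apply: freeW.
exact: (solution_eq0 rpK openD connD contA (is_solution_mulr c solW) Dx0 Wc).
Qed.

(* If Y_0(x0) c = 0 for a constant vector c, then Y c vanishes at order 0 in
   rho, so it is rho times a solution, which spanning writes as Y d; freeness
   applied to Y (c - rho d) = 0 gives c = 0. *)
Lemma formal_fundamental_unitmx (Y : K -> mxseries K n n) (x0 : K) :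
  is_formal_fundamental D A B Y -> D x0 -> Y x0 0%N \in unitmx.
Proof.
move=> [solY freeY spanY] Dx0; apply: mulmx_cV_inj_unitmx => c Yc.
have {Yc}Y0c x : D x -> Y x 0%N *m c = 0.
  exact: (solution_eq0 rpK openD connD contA
    (is_solution_mulr c (formal_solution0 solY)) Dx0 Yc).
have [|d dE] := spanY (fun x k => Y x k.+1 *m c).
  move=> k.
  apply: (mx_derive_on_eq openD _ _ (mx_derive_on_mul (solY k.+1)
    (mx_derive_on_cst c))) => // x Dx.
  rewrite mulmx0 addr0 mxseries_mul_deformedS mulmxDl -!mulmxA.
  case: k => [|k]; first by rewrite mxseries_mul_deformed0 Y0c // mulmx0 addr0.
  by rewrite mxseries_mul_deformedS.
apply: (freeY (fun k => if k is k'.+1 then - d k' else c) _ 0%N) => x Dx [|k].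
  by rewrite mxseries_mul_coef0 Y0c.
rewrite /mxseries_mul big_ord_recr /= subnn dE // /mxseries_mul -big_split /=.
apply: big1 => i _.
have ik : (i <= k)%N by rewrite -ltnS.
by rewrite (subSn ik) mulmxN addNr.
Qed.

(** * The Dyson series as a formal fundamental matrix *)

Section Dyson.
Variables (W Z : K -> 'M[K]_n) (C : nat -> K -> 'M[K]_n).
Hypothesis fundW : is_fundamental D A W.
Hypothesis defZ : forall x, D x -> Z x = invmx (W x).
Hypothesis intC : iterated_integrals D (fun x => Z x *m B x *m invmx (Z x)) C.

Let unitW x : D x -> W x \in unitmx.
Proof. exact: fundamental_unitmx. Qed.

Lemma dyson_series0 x : D x -> dyson_series W C x 0%N = W x.
Proof. by move=> Dx; rewrite /dyson_series intC.1 // mulmx1. Qed.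

Lemma dyson_formal_solution : is_formal_solution D A B (dyson_series W C).
Proof.
have [solW _ _] := fundW.
case=> [|k].
  apply: (mx_derive_on_eq openD _ _ solW) => x Dx; first by rewrite dyson_series0.
  by rewrite mxseries_mul_deformed0 dyson_series0.
apply: (mx_derive_on_eq openD _ _ (mx_derive_on_mul solW (intC.2 k))) => // x Dx.
(* Since [invmx (Z x)] is [W x], the factor W Z cancels and leaves B W C_k. *)
rewrite mxseries_mul_deformedS defZ // invmxK !mulmxA mulmxV ?unitW//.
by rewrite mul1mx.
Qed.

Lemma dyson_formal_fundamental : is_formal_fundamental D A B (dyson_series W C).
Proof.
split; first exact: dyson_formal_solution.
- move=> c Yc; have [_ freeW _] := fundW.
  (* If the coefficients of [c] below order l vanish, order l of the product is W c_l, and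
     independence of the columns of [W] applies. *)
  suff c0 k : forall l, (l < k)%N -> c l = 0 by move=> k; exact: (c0 k.+1).
  elim: k => // k IH l; rewrite ltnS leq_eqVlt => /orP[/eqP->|]; last exact: IH.
  apply: freeW => x Dx; rewrite -(dyson_series0 Dx) -[RHS](Yc x Dx k).
  rewrite /mxseries_mul big_ord_recl subn0 /= big1 ?addr0// => i _.
  by rewrite IH ?mulmx0// ltn_subrL /= (leq_ltn_trans _ (ltn_ord i)).
- move=> psi solpsi; have [[x0 Dx0]|D0] := pselect (D !=set0).
    have [|c cE] := formal_solution_factor dyson_formal_solution solpsi Dx0.
      by rewrite dyson_series0 // unitW.
    by exists c => x /cE ->.
  by exists (fun=> 0) => x Dx; case: D0; exists x.
Qed.

End Dyson.
End FormalSystem.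

(** * Change of basis between the Dyson series and the given fundamental matrix *)

(* The variable x ranges over a domain D of K, with K the real or the complex
   numbers; rho is a formal variable. *)
Theorem theorem2p2 (R : realType) (K : numFieldType)
    (hK : K = (R : numFieldType) \/ K = (complex R : numFieldType))
    (D : set K) (openD : open D) (connectedD : connected D)
    (n : nat) (A B : K -> 'M[K]_n)
    (contA : mx_continuous_on D A) (contB : mx_continuous_on D B)
    (W : K -> 'M[K]_n) (fundW : is_fundamental D A W)
    (Z : K -> 'M[K]_n) (defZ : forall x, D x -> Z x = invmx (W x))
    (Wrho : K -> mxseries K n n) (fundWrho : is_formal_fundamental D A B Wrho) :
  let M := fun x => Z x *m B x *m invmx (Z x) in
  [/\ (* W is invertible on D, so that Z is its inverse *)
      (forall x, D x -> W x \in unitmx),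
      (* Wrho is a Dyson series, up to a change of basis by a constant matrix *)
      (exists C : nat -> K -> 'M[K]_n, exists2 P0 : 'M[K]_n,
         iterated_integrals D M C /\ P0 \in unitmx &
         forall x, D x -> forall k, Wrho x k = dyson_series W C x k *m P0)
    & (* every choice of the integrals gives a fundamental matrix, which agrees
         with Wrho up to a change of basis by a matrix constant in x *)
      (forall C : nat -> K -> 'M[K]_n, iterated_integrals D M C ->
         is_formal_fundamental D A B (dyson_series W C) /\
         exists2 P : mxseries K n n, mxseries_invertible P &
         forall x, D x -> Wrho x =1 mxseries_mul (dyson_series W C x) P)].
Proof.
move=> M.
have [iota [re rpK]] := real_projection_exists hK.
have unitW x : D x -> W x \in unitmx.
  exact: (fundamental_unitmx rpK openD connectedD contA fundW).
have [solW _ _] := fundW; have [solY _ _] := fundWrho.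
have unitY x : D x -> Wrho x 0%N \in unitmx.
  exact: (formal_fundamental_unitmx rpK openD connectedD contA fundWrho).
split => //.
(* [W] and the order 0 coefficient of [Wrho] both solve Y' = A Y, so they differ by the constant
   matrix read off at [x0]. *)
- have [P0 P0unit P0E] : exists2 P0 : 'M[K]_n, P0 \in unitmx &
      forall x, D x -> Wrho x 0%N = W x *m P0.
    have [[x0 Dx0]|D0] := pselect (D !=set0); last first.
      exists 1%:M; first exact: unitmx1.
      by move=> x Dx; case: D0; exists x.
    exists (invmx (W x0) *m Wrho x0 0%N).
      by rewrite unitmx_mul unitmx_inv unitW // unitY.
    move=> x Dx; apply/eqP; rewrite -subr_eq0; apply/eqP; move: x Dx.
    apply: (solution_eq0 rpK openD connectedD contA _ Dx0).
      apply: (mx_derive_on_eq openD _ _ (mx_derive_on_sub (formal_solution0 openD solY)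
        (is_solution_mulr openD _ solW))) => // x _.
      by rewrite mulmxBr.
    by rewrite mulKVmx ?subrr// unitW.
  (* Solving W C_k P0 = Y_k for C_k, with Y_k the coefficients of [Wrho]; the factor [invmx P0]
     normalises C_0 to I. In the derivative, the term -Z A Y from Z' cancels Z A Y from Y', leaving
     the [B] term. *)
  exists (fun k x => invmx (W x) *m Wrho x k *m invmx P0), P0; first split => //.
    split => [x Dx|k]; first by rewrite P0E // mulKmx ?unitW// mulmxV.
    apply: (mx_derive_on_eq openD _ _ (mx_derive_on_mul
      (mx_derive_on_mul (mx_derive_on_inv openD solW unitW) (solY k.+1))
      (mx_derive_on_cst (invmx P0)))) => // x Dx.
    rewrite mulmx0 addr0 mxseries_mul_deformedS /M defZ // invmxK !mulmxA.
    rewrite mulmxDr mulNmx !mulmxA addKr; congr (_ *m _).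
    by rewrite -[in RHS](mulmxA _ (W x)) mulmxV ?unitW// mulmx1.
  move=> x Dx k; rewrite /dyson_series mulmxA mulmxKV // mulmxA mulmxV ?unitW//.
  by rewrite mul1mx.
- move=> C intC; split.
    exact: (dyson_formal_fundamental rpK openD connectedD contA fundW defZ intC).
  have [[x0 Dx0]|D0] := pselect (D !=set0); last first.
    exists (@mxseries1 K n); last by move=> x Dx; case: D0; exists x.
    exact/mxseries_unit_invertible/unitmx1.
  have [|P PE] := formal_solution_factor rpK openD connectedD contA
      (dyson_formal_solution rpK openD connectedD contA fundW defZ intC) solY Dx0.
    by rewrite (dyson_series0 _ intC) // unitW.
  exists P; last by move=> x /PE ->.
  (* At order 0 and at [x0], the invertible coefficient of [Wrho] has [P 0] as its right factor. *)
  apply: mxseries_unit_invertible.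
  have := unitY x0 Dx0; rewrite PE // mxseries_mul_coef0 unitmx_mul.
  by move=> /andP[].
Qed.
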